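(* Let $G$ and $H$ be two rooted graphs. Then $$U^r(G\cdot H)=U^r(G)\,\bigl(U^r(H)+U(H)\bigr).$$
   Context: Graphs are finite, with loops and parallel edges allowed. A rooted graph is a pair $(G,v_0)$ with $G=(V,E)$ a graph and $v_0\in V$ its root. For rooted graphs $(G,v)$ and $(H,v')$, $G\cdot H$ is the rooted graph obtained from the disjoint union of $G$ and $H$ by adding an edge between $v$ and $v'$ and declaring $v$ (the root of $G$) to be the root. Let $y,z,x_1,x_2,\dots$ be commuting indeterminates; for a partition $\lambda=(\lambda_1,\dots,\lambda_s)$ put $\mathbf{x}_\lambda=x_{\lambda_1}\cdots x_{\lambda_s}$ ($=1$ for the empty partition). For $A\subseteq E$, $G|_A$ is the spanning subgraph with edge set $A$ (all vertices kept), $k(G|_A)$ is its number of connected components, $r(A)=|V|-k(G|_A)$, and $\lambda(A)$ is the partition of $|V|$ whose parts are the numbers of vertices of the components of $G|_A$. The $U$-polynomial (of the underlying unrooted graph) is $U(G)=\sum_{A\subseteq E}\mathbf{x}_{\lambda(A)}(y-1)^{|A|-r(A)}$. Let $\lambda_r(A)$ be the number of vertices of the component of $G|_A$ containing the root, and $\lambda_-(A)$ the partition formed by the numbers of vertices of all other components. The rooted $U$-polynomial is $$U^r(G)=\sum_{A\subseteq E}\mathbf{x}_{\lambda_-(A)}z^{\lambda_r(A)}(y-1)^{|A|-r(A)}.$$ *)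

(* Defs.v *)
From HB Require Import structures.
From mathcomp Require Export all_boot all_order all_algebra.
From mathcomp Require Export monalg.

Set Implicit Arguments.
Unset Strict Implicit.
Unset Printing Implicit Defensive.

Import GRing.Theory.
Local Open Scope ring_scope.

(* Each edge lists its two endpoints in an arbitrary order that no definition
   below depends on; [edge] is a type, so parallel edges are distinct elements,
   and a loop has [ends e = (v, v)]. *)
Record mgraph := MGraph {
  vert : finType;
  edge : finType;
  ends : edge -> vert * vert
}.

Record rooted_graph := RootedGraph {
  ugraph :> mgraph;
  root : vert ugraph
}.

Definition rjoin_ends (G H : rooted_graph) (e : option (edge G + edge H)) :
    (vert G + vert H) * (vert G + vert H) :=
  match e with
  | None => (inl (root G), inr (root H))
  | Some (inl a) => (inl (ends a).1, inl (ends a).2)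
  | Some (inr b) => (inr (ends b).1, inr (ends b).2)
  end.

Definition rjoin (G H : rooted_graph) : rooted_graph :=
  @RootedGraph (MGraph (@rjoin_ends G H)) (inl (root G)).

Section Components.
Variable G : mgraph.

Definition adj : rel (vert G) :=
  [rel u v | [exists e : edge G, (ends e == (u, v)) || (ends e == (v, u))]].

Definition components : {set {set vert G}} :=
  equivalence_partition (connect adj) [set: vert G].

Definition component_of (v : vert G) : {set vert G} := pblock components v.

Definition spanning (A : {set edge G}) : mgraph :=
  @MGraph (vert G) {e : edge G | e \in A} (fun e => ends (val e)).

End Components.

(* A partition is represented by the nonincreasing sequence of its parts. *)
Definition sizes (T : finType) (P : {set {set T}}) : seq nat :=
  sort geq [seq #|C| | C : {set T} in P].

Section EdgeSubset.
Variables (G : mgraph) (A : {set edge G}).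

Definition ncomp : nat := #|components (spanning A)|.

(* The truncated subtraction is exact, since there are at most #|vert G|
   components; so is the one in [#|A| - rank A] below, since a graph with a
   given number of vertices and components has at least rank-many edges. *)
Definition rank : nat := (#|vert G| - ncomp)%N.

Definition lambda : seq nat := sizes (components (spanning A)).

Definition lambda_at (v : vert G) : nat :=
  #|component_of (G := spanning A) v|.

Definition lambda_off (v : vert G) : seq nat :=
  sizes (components (spanning A) :\ component_of (G := spanning A) v).

End EdgeSubset.

(* The indeterminates y, z and x_i.  [IX 0] is never used, since all parts of a
   partition are positive. *)
Inductive indet := IY | IZ | IX of nat.

Definition indet_code (i : indet) : option (option nat) :=
  match i with IY => None | IZ => Some None | IX n => Some (Some n) end.

Definition indet_decode (c : option (option nat)) : indet :=
  match c with None => IY | Some None => IZ | Some (Some n) => IX n end.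

Lemma indet_codeK : cancel indet_code indet_decode.
Proof. by case. Qed.

HB.instance Definition _ := Countable.copy indet (can_type indet_codeK).

Definition Upoly : comNzRingType := {malg int[{cmonom indet}]}.

Definition ind (i : indet) : Upoly := << ucm i >>.

Definition x_part (s : seq nat) : Upoly := \prod_(n <- s) ind (IX n).

Definition U (G : mgraph) : Upoly :=
  \sum_(A : {set edge G}) x_part (lambda A) * (ind IY - 1) ^+ (#|A| - rank A).

Definition Ur (G : rooted_graph) : Upoly :=
  \sum_(A : {set edge G})
     x_part (lambda_off A (root G)) * ind IZ ^+ lambda_at A (root G) *
     (ind IY - 1) ^+ (#|A| - rank A).

(* Main.v *)
Require Import Defs.
From mathcomp Require Import zify.

(** A set of edges of the join is a triple [(b, B, C)]: a set [B] of edges of [G],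
    a set [C] of edges of [H], and a bit [b] saying whether the bridge is kept
    ([join_edges_bij]).

    Without the bridge, the components are those of [B] and those of [C].  The
    root component is that of [B], so every component of [C] counts as a
    non-root one and contributes an [x] factor, which gives a term of [U H].
    With the bridge, the two root components merge into the root component of
    the join, the powers of [z] multiply, and only the non-root components of
    [C] contribute [x] factors, which gives a term of [Ur H].  In both cases the
    bridge is in no cycle, so the nullities of [B] and [C] add up.  Hence every
    term of [Ur (rjoin G H)] is a product of a term of [Ur G] and a term of
    [Ur H] (bridge) or [U H] (no bridge), see [Ur_term_join]; summing over the
    triples gives the product formula.

    Connectivity in the join is computed in [conn_joinE], from which its
    components are read off in [component_root] and [other_components_join].
    Since the exponents of [y - 1] are truncated subtractions, their additivity
    also needs that a graph has at least as many edges as its rank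
    ([card_vert_le]). *)

Set Implicit Arguments.
Unset Strict Implicit.
Unset Printing Implicit Defensive.

Import GRing.Theory.
Local Open Scope ring_scope.

(** * Connectivity and components *)

Definition conn (G : mgraph) : rel (vert G) := connect (@adj G).
Arguments conn : clear implicits.

Lemma adj_sym (G : mgraph) : symmetric (@adj G).
Proof. by move=> u v; apply: eq_existsb => e; rewrite orbC. Qed.

Lemma conn_sym (G : mgraph) : symmetric (conn G).
Proof. exact: sym_connect_sym (@adj_sym G). Qed.

Lemma conn0 (G : mgraph) (u : vert G) : conn G u u.
Proof. exact: connect0. Qed.

Lemma conn_trans (G : mgraph) : transitive (conn G).
Proof. exact: connect_trans. Qed.

(** The induction principle that reduces claims about connectivity to claims
    about single edges. *)
Lemma conn_min (G : mgraph) (R : rel (vert G)) :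
  reflexive R -> transitive R -> subrel (@adj G) R -> subrel (conn G) R.
Proof.
move=> Rxx Rtr adjR u v /connectP[p]; elim: p u => [|w p IH] u /= => [_ -> // | ].
by case/andP=> /adjR uw pp lw; apply: Rtr uw (IH _ pp lw).
Qed.

Lemma conn_equiv (G : mgraph) :
  {in [set: vert G] & &, equivalence_rel (conn G)}.
Proof.
move=> u v w _ _ _; split=> [|uv]; first exact: conn0.
exact: (same_connect (@conn_sym G)).
Qed.

Lemma components_partition (G : mgraph) :
  partition (components G) [set: vert G].
Proof. exact: equivalence_partitionP (@conn_equiv G). Qed.

Lemma mem_component (G : mgraph) (u v : vert G) :
  (v \in component_of u) = conn G u v.
Proof.
exact: (pblock_equivalence_partition (@conn_equiv G) (in_setT u) (in_setT v)).
Qed.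

Lemma component_eq (G : mgraph) (u v : vert G) :
  (component_of u == component_of v) = conn G u v.
Proof.
have /and3P[/eqP cov tI _] := components_partition G.
by rewrite /component_of eq_pblock ?cov ?inE // -mem_component.
Qed.

Lemma component_mem (G : mgraph) (u : vert G) : component_of u \in components G.
Proof.
have /and3P[/eqP cov _ _] := components_partition G.
by apply: pblock_mem; rewrite cov inE.
Qed.

Lemma componentsP (G : mgraph) (C : {set vert G}) :
  reflect (exists u, C = component_of u) (C \in components G).
Proof.
have /and3P[_ tI n0] := components_partition G.
apply: (iffP idP) => [CG | [u ->]]; last exact: component_mem.
have /set0Pn[u uC] : C != set0 by apply: contraNneq n0 => <-.
by exists u; rewrite /component_of (def_pblock tI CG uC).
Qed.

Lemma componentsE (G : mgraph) :
  components G = [set component_of u | u in [set: vert G]].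
Proof.
apply/setP=> C; apply/componentsP/imsetP => [[u ->] | [u _ ->]]; last by exists u.
by exists u; rewrite ?inE.
Qed.

(** Indexing the non-root components by vertices turns questions about them
    into questions about connectivity to the root. *)
Lemma other_componentsE (G : mgraph) (v : vert G) :
  components G :\ component_of v =
  [set component_of u | u in [set u | ~~ conn G v u]].
Proof.
apply/setP=> C; rewrite in_setD1; apply/andP/imsetP => [[neC /componentsP[u Cu]] | [u]].
  by exists u => //; rewrite inE -component_eq eq_sym -Cu.
by rewrite inE -component_eq eq_sym => neq ->; rewrite component_mem.
Qed.

(** * Nonnegativity of the nullity *)

(** A counting argument over the two-element field: a set [X] of vertices is
    determined by its cut (the edges with exactly one end in [X]) together with
    its trace on a transversal of the components.  Indeed, two sets with the same
    cut have a symmetric difference that is a union of components, and this union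
    is empty if it meets no representative.  So there are at most as many vertex
    sets as pairs of an edge set and a set of components. *)
Lemma card_vert_le (G : mgraph) : (#|vert G| <= #|edge G| + #|components G|)%N.
Proof.
set P := components G.
have trP := transversalP (components_partition G).
set Tr := transversal P [set: vert G] in trP.
pose cut (X : {set vert G}) :=
  [set e : edge G | ((ends e).1 \in X) != ((ends e).2 \in X)].
pose code X := (cut X, X :&: Tr).
have code_inj : injective code.
  move=> X Y [/setP eq_cut /setP eqTr]; apply/setP=> v.
  pose d u := (u \in X) (+) (u \in Y).
  (* The symmetric difference of [X] and [Y] is constant along every edge. *)
  have dconn u w : conn G u w -> d u == d w.
    move: u w; apply: conn_min => [u | u w x /eqP-> // | u w /existsP[e eP]].
      exact: eqxx.
    move: (eq_cut e); rewrite !inE /d.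
    by case/orP: eP => /eqP -> /=; do 4 case: (_ \in _).
  set w := transversal_repr v Tr (component_of v).
  have wC : w \in component_of v by apply: (repr_mem_pblock trP); exact: component_mem.
  have wTr : w \in Tr by apply: (repr_mem_transversal trP); exact: component_mem.
  have := dconn v w; rewrite -mem_component => /(_ wC).
  have := eqTr w; rewrite !inE wTr !andbT /d => ->; rewrite addbb.
  by do 2 case: (_ \in _).
have : (#|code @: setT| <= #|setX [set: {set edge G}] (powerset Tr)|)%N.
  apply: subset_leq_card; apply/subsetP=> _ /imsetP[X _ ->].
  by rewrite !inE /= subsetIr.
rewrite card_imset // cardsX card_powerset -!powersetT !card_powerset !cardsT.
by rewrite -expnD leq_exp2l // (card_transversal trP).
Qed.

Lemma card_vert_le_ncomp (G : mgraph) (A : {set edge G}) :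
  (#|vert G| <= #|A| + ncomp A)%N.
Proof. by have := card_vert_le (spanning A); rewrite /= card_sig. Qed.

Lemma ncomp_le_card_vert (G : mgraph) (A : {set edge G}) : (ncomp A <= #|vert G|)%N.
Proof. by rewrite /ncomp componentsE (leq_trans (leq_imset_card _ _)) // cardsT. Qed.

(** * Spanning subgraphs and products over partitions *)

Lemma adj_spanning (G : mgraph) (A : {set edge G}) (u v : vert G) :
  @adj (spanning A) u v =
  [exists e in A, (ends e == (u, v)) || (ends e == (v, u))].
Proof.
apply/existsP/exists_inP => [[[e eA] eP] | [e eA eP]]; first by exists e.
by exists (exist _ e eA).
Qed.

Lemma x_part_sizes (T : finType) (P : {set {set T}}) :
  x_part (sizes P) = \prod_(C in P) ind (IX #|C|).
Proof.
rewrite /x_part /sizes (perm_big _ (permEl (perm_sort _ _))) /= big_map.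
by rewrite big_enum.
Qed.

Lemma big_disjoint_setU (R : Type) (idx : R) (op : Monoid.com_law idx)
    (T : finType) (X Y : {set T}) (F : T -> R) :
  [disjoint X & Y] ->
  \big[op/idx]_(x in X :|: Y) F x =
  op (\big[op/idx]_(x in X) F x) (\big[op/idx]_(x in Y) F x).
Proof. by move=> dXY; rewrite -bigU //; apply: eq_bigl => x; rewrite !inE. Qed.

(** * Connectivity in the join *)

Section Join.
Variables (G H : rooted_graph).
Variables (b : bool) (B : {set edge G}) (C : {set edge H}).

Definition join_edges : {set edge (rjoin G H)} :=
  [set e : option (edge G + edge H) | match e with
   | None => b | Some (inl e1) => e1 \in B | Some (inr e2) => e2 \in C end].

Local Notation GB := (spanning B).
Local Notation HC := (spanning C).
Local Notation J := (spanning join_edges).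

(** Connectivity in the disjoint union, that is, without the bridge. *)
Definition split_conn (s t : vert G + vert H) : bool :=
  match s, t with
  | inl u, inl v => conn GB u v
  | inr u, inr v => conn HC u v
  | _, _ => false
  end.

Definition anchored (s : vert G + vert H) : bool :=
  match s with inl u => conn GB (root G) u | inr v => conn HC (root H) v end.

(** A walk that uses the bridge goes through both roots, so the bridge only adds
    connections between vertices that are both connected to their own root.  Written
    as a disjunction, so that transitivity splits according to the uses of the
    bridge and not according to the positions of the vertices. *)
Definition join_conn (s t : vert G + vert H) : bool :=
  split_conn s t || [&& b, anchored s & anchored t].

Lemma split_conn_anchored s t : split_conn s t -> anchored s = anchored t.
Proof.
by case: s t => u [] v //= uv; apply/idP/idP => h; apply: conn_trans h _;
  rewrite // conn_sym.
Qed.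

Lemma join_conn_trans : transitive join_conn.
Proof.
move=> t s w; rewrite /join_conn.
case/orP=> [st | /and3P[-> -> st]]; case/orP=> [tw | /and3P[bT tt aw]].
- apply/orP; left; move: s t w st tw => [s|s] [t|t] [w|w] //=; exact: conn_trans.
- by rewrite bT (split_conn_anchored st) tt aw orbT.
- by rewrite -(split_conn_anchored tw) st orbT.
- by rewrite aw orbT.
Qed.

Lemma adj_join s t : @adj J s t -> join_conn s t.
Proof.
have ends_conn (K : mgraph) (D : {set edge K}) e :
    e \in D -> conn (spanning D) (ends e).1 (ends e).2.
  move=> eD; apply: connect1; rewrite adj_spanning; apply/exists_inP; exists e => //.
  by rewrite -surjective_pairing eqxx.
rewrite adj_spanning /join_conn; case/exists_inP => -[[e|e]|]; rewrite inE => eA.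
- by case/orP=> /eqP[<- <-] /=; rewrite ?[conn _ (_.2) _]conn_sym ends_conn.
- by case/orP=> /eqP[<- <-] /=; rewrite ?[conn _ (_.2) _]conn_sym ends_conn.
- by case/orP=> /eqP[<- <-] /=; rewrite eA !conn0.
Qed.

Lemma conn_joinE s t : conn J s t = join_conn s t.
Proof.
have connl : subrel (conn GB) (fun u v => conn J (inl u) (inl v)).
  apply: conn_min => [u | u v w | u v]; [exact: conn0 | exact: conn_trans | ].
  rewrite adj_spanning => /exists_inP[e eB eP]; apply: connect1; rewrite adj_spanning.
  by apply/exists_inP; exists (Some (inl e)); rewrite ?inE.
have connr : subrel (conn HC) (fun u v => conn J (inr u) (inr v)).
  apply: conn_min => [u | u v w | u v]; [exact: conn0 | exact: conn_trans | ].
  rewrite adj_spanning => /exists_inP[e eB eP]; apply: connect1; rewrite adj_spanning.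
  by apply/exists_inP; exists (Some (inr e)); rewrite ?inE.
apply/idP/idP => [|/orP[|/and3P[bT]]].
- apply: (@conn_min J join_conn); last exact: adj_join.
    by case=> u; rewrite /join_conn /= conn0.
  exact: join_conn_trans.
- by case: s t => u [] v //=; [exact: connl | exact: connr].
have bridge : conn J (inl (root G)) (inr (root H)).
  apply: connect1; rewrite adj_spanning.
  by apply/exists_inP; exists None; rewrite ?inE //= eqxx.
have to_root w : anchored w -> conn J (inl (root G)) w.
  by case: w => w /= aw; [exact: connl | apply: conn_trans bridge _; exact: connr].
by move=> /to_root rs /to_root; apply: conn_trans; rewrite conn_sym.
Qed.

(** * Components of the join *)

(** The hypothesis excludes exactly the component that the bridge merges. *)
Lemma component_inl u : ~~ (b && conn GB (root G) u) ->
  component_of (G := J) (inl u) = inl @: component_of (G := GB) u.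
Proof.
move=> off; apply/setP=> -[v|v];
  rewrite mem_component conn_joinE /join_conn /= andbA (negPf off).
  by rewrite orbF -mem_component (mem_imset _ _ inl_inj).
by apply/esym/imsetP => -[].
Qed.

Lemma component_inr v : ~~ (b && conn HC (root H) v) ->
  component_of (G := J) (inr v) = inr @: component_of (G := HC) v.
Proof.
move=> off; apply/setP=> -[u|u];
  rewrite mem_component conn_joinE /join_conn /= andbA (negPf off).
  by apply/esym/imsetP => -[].
by rewrite orbF -mem_component (mem_imset _ _ inr_inj).
Qed.

Lemma component_root :
  component_of (G := J) (inl (root G)) =
  (inl @: component_of (G := GB) (root G)) :|:
  (if b then inr @: component_of (G := HC) (root H) else set0).
Proof.
apply/setP=> -[u|u]; rewrite mem_component conn_joinE /join_conn !inE /= conn0.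
  rewrite -!mem_component (mem_imset _ _ inl_inj).
  by case: b; rewrite ?inE //= orbb (introF imsetP) ?orbF // => -[].
rewrite (introF imsetP) /=; last by case.
by case: b; rewrite ?inE // -mem_component (mem_imset _ _ inr_inj).
Qed.

(** Without the bridge, the root component of [C] is a non-root component of the
    join. *)
Definition free_comps : {set {set vert H}} :=
  if b then components HC :\ component_of (G := HC) (root H) else components HC.

Lemma other_components_join :
  components J :\ component_of (G := J) (inl (root G)) =
  [set inl @: D | D : {set vert G} in
     components GB :\ component_of (G := GB) (root G)] :|:
  [set inr @: D | D : {set vert H} in free_comps].
Proof.
have freeE : free_comps =
    [set component_of (G := HC) v | v in [set v | ~~ (b && conn HC (root H) v)]].
  rewrite /free_comps; case: b; first by rewrite other_componentsE.
  by rewrite componentsE; congr (imset _ _); apply/setP=> v; rewrite !inE.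
rewrite !other_componentsE freeE -!imset_comp; apply/setP=> S.
have offE t : conn J (inl (root G)) t =
    match t with inl u => conn GB (root G) u | inr v => b && conn HC (root H) v end.
  by rewrite conn_joinE /join_conn /= conn0; case: t => // u; case: b;
     rewrite ?orbF ?orbb.
apply/imsetP/setUP => [[[u|v]] | [] /imsetP[u]]; rewrite inE ?offE => off.
- move=> ->; left; apply/imsetP; exists u; rewrite ?inE //=.
  by rewrite component_inl // negb_and off orbT.
- by move=> ->; right; apply/imsetP; exists v; rewrite ?inE //= component_inr.
- move=> ->; exists (inl u); rewrite ?inE ?offE //=.
  by rewrite component_inl // negb_and off orbT.
- by move=> ->; exists (inr u); rewrite ?inE ?offE //= component_inr.
Qed.

(** Stated for any commutative monoid, as it serves twice: with addition to count
    the components, and with multiplication to factor the [x] variables. *)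
Lemma big_other_components (R : Type) (idx : R) (op : Monoid.com_law idx) (F : nat -> R) :
  \big[op/idx]_(D in components J :\ component_of (G := J) (inl (root G))) F #|D| =
  op (\big[op/idx]_(D in components GB :\ component_of (G := GB) (root G)) F #|D|)
     (\big[op/idx]_(D in free_comps) F #|D|).
Proof.
rewrite other_components_join big_disjoint_setU /=; last first.
  rewrite disjoint_sym; apply/pred0P=> S /=.
  apply/andP => -[/imsetP[D Dfree ->] /imsetP[E _ eqDE]].
  (* An image on the left and one on the right differ since blocks are nonempty. *)
  have /set0Pn[v vD] : D != set0.
    have [_ _ n0] := and3P (components_partition HC).
    apply: contraNneq n0 => <-; move: Dfree; rewrite /free_comps.
    by case: b => //; rewrite inE => /andP[].
  have : inr v \in inl @: E by rewrite -eqDE imset_f.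
  by case/imsetP.
rewrite (big_imset _ (in2W (imset_inj inl_inj))) (big_imset _ (in2W (imset_inj inr_inj))).
congr (op _ _); apply: eq_bigr => D _.
  by rewrite (card_imset _ inl_inj).
by rewrite (card_imset _ inr_inj).
Qed.

Lemma lambda_at_join :
  lambda_at (G := rjoin G H) join_edges (inl (root G)) =
  (lambda_at B (root G) + (if b then lambda_at C (root H) else 0))%N.
Proof.
rewrite /lambda_at component_root cardsU disjoint_setI0 ?cards0 ?subn0.
  rewrite card_imset; last exact: inl_inj.
  by case: b; rewrite ?cards0 // card_imset //; exact: inr_inj.
apply/pred0P => s /=; apply/andP=> -[/imsetP[u _ ->]]; case: b; last by rewrite inE.
by case/imsetP.
Qed.

Lemma ncompS (K : mgraph) (D : {set edge K}) (v : vert K) :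
  ncomp D = (#|components (spanning D) :\ component_of (G := spanning D) v|).+1.
Proof. by rewrite /ncomp (cardsD1 (component_of (G := spanning D) v)) component_mem. Qed.

(** The bridge always merges two components, namely those of the two roots. *)
Lemma ncomp_join : (ncomp join_edges + b = ncomp B + ncomp C)%N.
Proof.
rewrite (ncompS join_edges (inl (root G) : vert (rjoin G H))) (ncompS B (root G)).
rewrite -sum1_card (big_other_components _ (fun=> 1%N)) !sum1_card /free_comps.
by case: b; [rewrite (ncompS C (root H)) | rewrite /ncomp] => /=; lia.
Qed.

Lemma card_join_edges : #|join_edges| = (b + (#|B| + #|C|))%N.
Proof.
pose E := [set e : edge G + edge H |
  match e with inl e1 => e1 \in B | inr e2 => e2 \in C end].
have -> : #|join_edges| = (b + #|E|)%N.
  rewrite (cardsD1 None) inE -(card_imset E Some_inj); congr (_ + #|pred_of_set _|)%N.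
  apply/setP=> -[e|]; rewrite !inE /=; last by apply/esym/imsetP; case.
  by rewrite (mem_imset _ _ Some_inj) inE.
congr addn; rewrite -!sum1_card big_mkcond big_sumType /= -!big_mkcond.
by congr addn; apply: eq_bigl => e; rewrite !inE.
Qed.

(** With the bridge, both the number of edges and the rank grow by one.  The
    truncated subtractions add up because the rank is at most the number of edges
    on each side. *)
Lemma nullity_join :
  (#|join_edges| - rank join_edges)%N = ((#|B| - rank B) + (#|C| - rank C))%N.
Proof.
rewrite card_join_edges /rank card_sum.
move: ncomp_join (card_vert_le_ncomp B) (card_vert_le_ncomp C)
  (ncomp_le_card_vert B) (ncomp_le_card_vert C).
move: #|vert G| #|vert H| #|B| #|C| (ncomp join_edges) (ncomp B) (ncomp C)
  (nat_of_bool b).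
move=> v w m n kJ kB kC d kJ_eq hB hC leB leC.
have -> : (v + w - kJ = d + ((v - kB) + (w - kC)))%N by lia.
have rB : (v - kB <= m)%N by rewrite leq_subLR addnC.
have rC : (w - kC <= n)%N by rewrite leq_subLR addnC.
by rewrite subnDl subnDA -(addnBAC _ rB) -addnBA.
Qed.

End Join.

(** * The product formula *)

Definition Ur_term (G : rooted_graph) (A : {set edge G}) : Upoly :=
  x_part (lambda_off A (root G)) * ind IZ ^+ lambda_at A (root G) *
  (ind IY - 1) ^+ (#|A| - rank A).

Definition U_term (G : mgraph) (A : {set edge G}) : Upoly :=
  x_part (lambda A) * (ind IY - 1) ^+ (#|A| - rank A).

(** Stated over an abstract ring, like the next lemma: rewriting with ring laws
    directly in [Upoly] makes unification unfold the monoid algebra. *)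
Lemma mulr_exprD_split (R : comNzRingType) (p q s t : R) (a c d e : nat) :
  p * q * s ^+ (a + c) * t ^+ (d + e) = p * s ^+ a * t ^+ d * (q * s ^+ c * t ^+ e).
Proof. by rewrite !exprD (mulrACA p) (mulrACA (p * _)). Qed.

Lemma sum_bool_product (R : pzSemiRingType) (I J : finType) (f : I -> R) (g h : J -> R) :
  \sum_b \sum_(p : I * J) f p.1 * (if b then g p.2 else h p.2) =
  (\sum_i f i) * (\sum_j g j + \sum_j h j).
Proof. by rewrite big_bool /= mulrDr !big_distrlr /= !pair_bigA. Qed.

(** With the bridge, the root component of [C] is absorbed and contributes only
    to the power of [z]; without it, [C] keeps all its components and contributes
    no power of [z]. *)
Lemma Ur_term_join (G H : rooted_graph) b (B : {set edge G}) (C : {set edge H}) :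
  Ur_term (G := rjoin G H) (join_edges b B C) =
  Ur_term B * (if b then Ur_term C else U_term C).
Proof.
rewrite /Ur_term /U_term nullity_join lambda_at_join !x_part_sizes.
rewrite (@big_other_components G H b B C _ _ _ (fun n => ind (IX n))) /free_comps /=.
rewrite [LHS](mulr_exprD_split (R := Upoly)).
congr (_ * _); case: b; first by reflexivity.
by rewrite expr0 mulr1; reflexivity.
Qed.

Lemma join_edges_bij (G H : rooted_graph) :
  bijective (fun p : bool * ({set edge G} * {set edge H}) => join_edges p.1 p.2.1 p.2.2).
Proof.
exists (fun A : {set option (edge G + edge H)} =>
  (None \in A, ([set e | Some (inl e) \in A], [set e | Some (inr e) \in A]))).
  by move=> [b [B C]]; congr (_, (_, _)); rewrite ?inE //; apply/setP=> e; rewrite !inE.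
by move=> A; apply/setP=> -[[e|e]|]; rewrite !inE.
Qed.

Theorem lemma5 (G H : rooted_graph) : Ur (rjoin G H) = Ur G * (Ur H + U H).
Proof.
rewrite -[Ur (rjoin G H)]/(\sum_A Ur_term (G := rjoin G H) A).
rewrite (reindex _ (onW_bij _ (join_edges_bij G H))).
rewrite (eq_bigr _ (fun p _ => Ur_term_join p.1 p.2.1 p.2.2)).
rewrite -(pair_bigA _
  (fun b p => Ur_term p.1 * (if b then Ur_term p.2 else U_term p.2))) /=.
exact: (sum_bool_product (@Ur_term G) (@Ur_term H) (@U_term H)).
Qed.
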